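(* Let $X$ be a locally compact space, $\kappa$ a strictly positive definite kernel on $X$, and $\mathbf A=(A_i)_{i\in I}$ a generalized condenser in $X$ with signs $(s_i)_{i\in I}$ and $c_\kappa(A_i)>0$ for all $i\in I$. Then $\mathcal E^+_\kappa(\mathbf A;X)$ is a semimetric space with the semimetric $(\boldsymbol\mu,\boldsymbol\mu_1)\mapsto\|\boldsymbol\mu-\boldsymbol\mu_1\|_{\mathcal E^+_\kappa(\mathbf A;X)}$ defined by either of the (equivalent) relations $$\|\boldsymbol\mu-\boldsymbol\mu_1\|_{\mathcal E^+_\kappa(\mathbf A;X)}:=\|R\boldsymbol\mu-R\boldsymbol\mu_1\|_\kappa,\qquad\|\boldsymbol\mu-\boldsymbol\mu_1\|^2_{\mathcal E^+_\kappa(\mathbf A;X)}=\sum_{i,j\in I}s_is_j\,\kappa(\mu^i-\mu^i_1,\mu^j-\mu^j_1),$$ and this space is isometric to its $R$-image in $\mathcal E_\kappa(X)$. This semimetric is a metric if and only if all the $A_i$, $i\in I$, are mutually essentially disjoint, i.e. $c_\kappa(A_i\cap A_j)=0$ for all $i\ne j$.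
   Context: $X$ is a locally compact Hausdorff space, metrizable and countable at infinity. A kernel $\kappa$ on $X$ is a symmetric lower semicontinuous function $X\times X\to[0,\infty]$. For signed Radon measures $\mu,\nu$ on $X$, $\kappa(\mu,\nu)=\iint\kappa(x,y)\,d\mu(x)\,d\nu(y)$ (when well defined). $\kappa$ is strictly positive definite if $\kappa(\mu,\mu)\geqslant0$ for every signed Radon measure $\mu$ for which it is well defined, and $\kappa(\mu,\mu)>0$ unless $\mu=0$. $\mathcal E_\kappa(X)$ is the set of signed Radon measures $\mu$ with $\kappa(\mu^+,\mu^+),\kappa(\mu^-,\mu^-),\kappa(\mu^+,\mu^-)$ all finite; it is a pre-Hilbert space with inner product $\kappa(\mu,\nu)$ and norm $\|\mu\|_\kappa=\sqrt{\kappa(\mu,\mu)}$. $\mathcal E^+_\kappa(Q;X)$ is the set of positive $\mu\in\mathcal E_\kappa(X)$ carried by $Q$ (i.e. $X\setminus Q$ is $\mu$-negligible). $c_\kappa(Q)=[\inf\{\kappa(\mu,\mu):\mu\in\mathcal E^+_\kappa(Q;X),\mu(Q)=1\}]^{-1}$ ($\inf\varnothing=+\infty$, $1/(+\infty)=0$, $1/0=+\infty$). A generalized condenser is an ordered finite collection $\mathbf A=(A_i)_{i\in I}$ ($I\neq\varnothing$) of nonempty locally closed subsets of $X$ (intersections of an open and a closed set), with signs $s_i=\pm1$, such that $A_i\cap A_j=\varnothing$ whenever $s_is_j=-1$. $\mathcal E^+_\kappa(\mathbf A;X)=\prod_{i\in I}\mathcal E^+_\kappa(A_i;X)$, and for $\boldsymbol\mu=(\mu^i)_{i\in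 I}$ in it $R\boldsymbol\mu=\sum_{i\in I}s_i\mu^i\in\mathcal E_\kappa(X)$. A semimetric satisfies all axioms of a metric except that distinct points may be at distance zero. *)

(* Defs.v *)
From HB Require Import structures.
From mathcomp Require Import all_boot all_order all_algebra.
From mathcomp Require Import all_classical all_reals all_analysis.
Set Implicit Arguments.
Unset Strict Implicit.
Unset Printing Implicit Defensive.
Import Order.TTheory GRing.Theory Num.Theory.
Import numFieldNormedType.Exports.
Local Open Scope classical_set_scope.
Local Open Scope ring_scope.

Section metric_spaces.
Context {R : realType} {T : Type}.

Definition semimetric_on (S : set T) (d : T -> T -> R) : Prop :=
  [/\ forall x y, S x -> S y -> 0 <= d x y,
      forall x, S x -> d x x = 0,
      forall x y, S x -> S y -> d x y = d y x
    & forall x y z, S x -> S y -> S z -> d x z <= d x y + d y z].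

Definition metric_on (S : set T) (d : T -> T -> R) : Prop :=
  semimetric_on S d /\ forall x y, S x -> S y -> d x y = 0 -> x = y.

Definition isometry_onto {T' : Type} (S : set T) (d : T -> T -> R)
    (S' : set T') (d' : T' -> T' -> R) (f : T -> T') : Prop :=
  f @` S = S' /\ forall x y, S x -> S y -> d' (f x) (f y) = d x y.

End metric_spaces.

Section spaces.
Context (R : realType) (X : topologicalType).

Definition metrizable : Prop :=
  exists d : X -> X -> R, metric_on [set: X] d /\
    forall (x : X) (U : set X),
      nbhs x U <-> exists2 e : R, 0 < e & [set y | d x y < e] `<=` U.

Definition countable_at_infinity : Prop :=
  exists K : nat -> set X, (forall n, compact (K n)) /\ \bigcup_n K n = setT.

Definition locally_closed (A : set X) : Prop :=
  exists U F : set X, [/\ open U, closed F & A = U `&` F].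

End spaces.

(* [X] is pointed only because [g_sigma_algebraType] asks for it *)
Definition borel (X : ptopologicalType) := g_sigma_algebraType (@open X).

Section signed_radon.
Context (R : realType) (X : ptopologicalType).

Definition bounded_borel (B : set X) : Prop :=
  precompact B /\ measurable (B : set (borel X)).

(* The positive and the negative part of a signed Radon measure may both have
   infinite mass, so its values are defined only on the relatively compact
   Borel sets. The value is set to 0 elsewhere, which makes equality of signed
   measures the equality of functions. *)
Definition is_signed_radon (mu : set X -> R) : Prop :=
  [/\ forall B, ~ bounded_borel B -> mu B = 0,
      forall F : (set X)^nat, (forall n, bounded_borel (F n)) ->
        trivIset setT F -> bounded_borel (\bigcup_n F n) ->
        (fun n => \sum_(0 <= i < n) mu (F i)) @ \oo --> mu (\bigcup_n F n)
    & forall B, bounded_borel B -> forall e : R, 0 < e ->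
        exists2 K, compact K /\ K `<=` B &
          forall C, bounded_borel C -> C `<=` B `\` K -> `|mu C| < e].

Definition signed_radon_pred : {pred set X -> R} :=
  fun mu => `[< is_signed_radon mu >].

Lemma signed_radon_submod_closed : submod_closed signed_radon_pred.
Proof.
split=> [|a mu nu /asboolP[mu0 muS muK] /asboolP[nu0 nuS nuK]]; apply/asboolP.
- split=> // [F _ _ _|B _ e e0].
  + by under eq_fun do rewrite big1//; exact: cvg_cst.
  + by exists set0 => [|C _ _]; [split; [exact: compact0|]|rewrite normr0].
- have E C : (a *: mu + nu) C = a * mu C + nu C by [].
  split=> [B nB|F bF tF bU|B bB e e0].
  + by rewrite E mu0// nu0// mulr0 addr0.
  + rewrite E; under eq_fun => n.
      under eq_bigr do rewrite E.
      rewrite big_split /= -mulr_sumr.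
      over.
    by apply: cvgD; [apply: cvgMr; exact: muS|exact: nuS].
  + have e2 : 0 < e / 2 by rewrite divr_gt0.
    have a1 : 0 < `|a| + 1 by rewrite ltr_wpDl.
    have [K [cK KB] HK] := muK B bB _ (divr_gt0 e2 a1).
    have [L [cL LB] HL] := nuK B bB _ e2.
    exists (K `|` L) => [|C bC CB].
      by split; [exact: compactU|rewrite subUset].
    have /(HK _ bC) lmu : C `<=` B `\` K.
      by move=> x /CB[Bx nKL]; split=> // Kx; apply: nKL; left.
    have /(HL _ bC) lnu : C `<=` B `\` L.
      by move=> x /CB[Bx nKL]; split=> // Kx; apply: nKL; right.
    rewrite E (le_lt_trans (ler_normD _ _))// [ltRHS](splitr e).
    rewrite ler_ltD// normrM.
    move: lmu; rewrite ltr_pdivlMr// => /ltW; apply: le_trans.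
    by rewrite mulrC ler_wpM2l// lerDl.
Qed.

HB.instance Definition _ := GRing.isSubmodClosed.Build R (set X -> R)
  signed_radon_pred signed_radon_submod_closed.

Record signedRadon := SignedRadon {
  signed_radon_val :> set X -> R;
  _ : signed_radon_val \in signed_radon_pred }.

HB.instance Definition _ := [isSub for signed_radon_val].
HB.instance Definition _ := [Choice of signedRadon by <:].
HB.instance Definition _ := [SubChoice_isSubLmodule of signedRadon by <:].

Lemma signed_radonP (mu : signedRadon) : is_signed_radon mu.
Proof. by case: mu => mu /= /asboolP. Qed.

End signed_radon.

Section parts.
Context (R : realType) (X : ptopologicalType).
Implicit Types mu : signedRadon R X.
Local Open Scope ereal_scope.

(* The Jordan decomposition of [mu], as two measures on all Borel sets *)
Definition pos_part mu : set (borel X) -> \bar R := fun B =>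
  ereal_sup [set (mu C)%:E | C in [set C | bounded_borel C /\ C `<=` B]].

Definition neg_part mu : set (borel X) -> \bar R := pos_part (- mu)%R.

Lemma bounded_borel0 : bounded_borel (@set0 X).
Proof. split; last exact: measurable0.
by rewrite precompact_closed; [exact: compact0|exact: closed0]. Qed.

Lemma bounded_borelI (A B : set X) : bounded_borel A ->
  measurable (B : set (borel X)) -> bounded_borel (A `&` B).
Proof.
move=> [pA mA] mB; split; last exact: measurableI.
by apply: precompact_subset pA; exact: subIsetl.
Qed.

Lemma signed_radon0 mu : mu set0 = 0%R.
Proof.
have [_ muS _] := signed_radonP mu.
have t0 : trivIset [set: nat] (fun=> @set0 X) by exact: trivIset_set0.
have := muS (fun=> set0) (fun=> bounded_borel0) t0.
rewrite bigcup0// => /(_ bounded_borel0).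
set u := (X in X @ _ --> _) => cu.
have cu' : (fun n => u n.+1) @ \oo --> mu set0 by rewrite cvg_shiftS.
have cd : (fun n => u n.+1 - u n)%R @ \oo --> 0%R.
  by rewrite -(subrr (mu set0)); exact: cvgB.
apply: (cvg_unique _ _ cd) => //; rewrite (_ : (fun n => _) = fun=> mu set0).
  exact: cvg_cst.
by apply/funext => n; rewrite /u big_nat_recr//= addrAC subrr add0r.
Qed.

Let pos_part0 mu : pos_part mu set0 = 0.
Proof.
rewrite /pos_part; apply/eqP; rewrite eq_le; apply/andP; split.
- apply: ge_ereal_sup => _ [C [_ +] <-]; rewrite subset0 => ->.
  by rewrite signed_radon0.
- apply: ereal_sup_ubound; exists set0; last by rewrite signed_radon0.
  by split; [exact: bounded_borel0|].
Qed.

Let pos_part_ge0 mu B : 0 <= pos_part mu B.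
Proof.
apply: ereal_sup_ubound; exists set0; last by rewrite signed_radon0.
by split; [exact: bounded_borel0|].
Qed.

Lemma bounded_borelU (A B : set X) :
  bounded_borel A -> bounded_borel B -> bounded_borel (A `|` B).
Proof.
move=> [pA mA] [pB mB]; split; last exact: measurableU.
by move: pA pB; rewrite !precompactE closureU; exact: compactU.
Qed.

Lemma signed_radonU mu (A B : set X) : bounded_borel A -> bounded_borel B ->
  A `&` B = set0 -> mu (A `|` B) = (mu A + mu B)%R.
Proof.
move=> bA bB AB0; have [_ muS _] := signed_radonP mu.
have bF n : bounded_borel (bigcup2 A B n).
  by case: n => [|[|n]] //=; exact: bounded_borel0.
have tF : trivIset setT (bigcup2 A B) by rewrite -trivIset_bigcup2.
have := muS _ bF tF; rewrite bigcup2E => /(_ (bounded_borelU bA bB)) cu.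
apply: (cvg_unique _ cu); first exact: norm_hausdorff.
apply: cvg_near_cst.
exists 2%N => // n /= n2; rewrite (big_cat_nat _ n2)//=.
rewrite [X in (_ + X)%R]big_nat [X in (_ + X)%R]big1 ?addr0 => [|i /andP[i2 _]]; last first.
  by rewrite /bigcup2; case: i i2 => [|[|i]]//= _; exact: signed_radon0.
by rewrite big_nat_recr//= big_nat1.
Qed.

Let le_pos_part mu (A B : set (borel X)) :
  A `<=` B -> pos_part mu A <= pos_part mu B.
Proof.
move=> AB; apply: ge_ereal_sup => _ [C [bC CA]] <-.
by apply: ereal_sup_ubound; exists C => //; split=> //; exact: subset_trans AB.
Qed.

Let le_pos_partU mu (A B : set (borel X)) : A `&` B = set0 ->
  pos_part mu A + pos_part mu B <= pos_part mu (A `|` B).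
Proof.
move=> AB0; have [->|] := eqVneq (pos_part mu (A `|` B)) +oo; first exact: leey.
rewrite -ltey => fM.
have fin (D : set (borel X)) : D `<=` A `|` B -> pos_part mu D \is a fin_num.
  by move=> DM; rewrite ge0_fin_numE// (le_lt_trans (le_pos_part _ DM)).
rewrite -leeBrDr; last by apply: fin; exact: subsetUr.
apply: ge_ereal_sup => _ [C [bC CA]] <-.
rewrite leeBrDr; last by apply: fin; exact: subsetUr.
rewrite addeC -leeBrDr//; apply: ge_ereal_sup => _ [D [bD DB]] <-.
rewrite leeBrDr// -EFinD addrC -signed_radonU//.
- apply: ereal_sup_ubound; exists (C `|` D) => //; split; last exact: setUSS.
  exact: bounded_borelU.
- by rewrite -subset0 -AB0; exact: setISS.
Qed.

Let pos_part_sigma_additive mu : semi_sigma_additive (pos_part mu).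
Proof.
move=> F mF tF mU.
have cF : cvgn (fun n => \sum_(0 <= i < n) pos_part mu (F i)).
  exact: is_cvg_nneseries.
apply: cvg_toP => //; apply/eqP; rewrite eq_le; apply/andP; split.
- apply: lime_le => //; apply: nearW => n.
  suff : \sum_(0 <= i < n) pos_part mu (F i)
      <= pos_part mu (\big[setU/set0]_(i < n) F i).
    move=> /le_trans; apply; apply: le_pos_part.
    exact: bigsetU_bigcup.
  elim: n => [|n ih]; first by rewrite big_nil.
  rewrite big_nat_recr// big_ord_recr/=.
  apply: le_trans (le_pos_partU _ _); first exact: leeD2r.
  by apply: (@trivIset_bigsetUI _ predT) => //; exact: sub_trivIset tF.
- apply: ge_ereal_sup => _ [C [bC CU]] <-.
  have [_ muS _] := signed_radonP mu.
  have CE : C = \bigcup_n (C `&` F n) by rewrite -setI_bigcupr; apply/esym/setIidl.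
  have tC : trivIset setT (fun n => C `&` F n) by exact: trivIset_setIl.
  have := muS _ (fun n => bounded_borelI bC (mF n)) tC.
  rewrite -CE => /(_ bC) cmu.
  have {}cmu : (fun n => \sum_(0 <= i < n) (mu (C `&` F i))%:E) @ \oo
      --> (mu C)%:E.
    by under eq_fun do rewrite sumEFin; apply: cvg_EFin => //; exact: nearW.
  rewrite -(cvg_lim _ cmu)//; apply: lee_lim => //.
    by apply/cvg_ex; exists (mu C)%:E.
  apply: nearW => n; apply: lee_sum => i _; apply: ereal_sup_ubound.
  exists (C `&` F i) => //; split; last exact: subIsetr.
  exact: bounded_borelI.
Qed.

HB.instance Definition _ mu := isMeasure.Build _ (borel X) R (pos_part mu)
  (pos_part0 mu) (pos_part_ge0 mu) (@pos_part_sigma_additive mu).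
HB.instance Definition _ mu := Measure.copy (neg_part mu) (pos_part (- mu)%R).

End parts.

Section energy.
Context {R : realType} {X : ptopologicalType} (kappa : X -> X -> \bar R).
Implicit Types (mu nu : signedRadon R X) (Q : set X).
Local Open Scope ereal_scope.

Definition is_kernel : Prop :=
  [/\ forall x y, 0 <= kappa x y,
      forall x y, kappa x y = kappa y x
    & lower_semicontinuous (fun z : X * X => kappa z.1 z.2)].

Definition energy_pos (m n : {measure set (borel X) -> \bar R}) : \bar R :=
  \int[n]_y \int[m]_x kappa x y.

Definition energy_like mu nu : \bar R :=
  energy_pos (pos_part mu) (pos_part nu) +
  energy_pos (neg_part mu) (neg_part nu).

Definition energy_cross mu nu : \bar R :=
  energy_pos (pos_part mu) (neg_part nu) +
  energy_pos (neg_part mu) (pos_part nu).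

Definition energy_defined mu nu : Prop :=
  energy_like mu nu < +oo \/ energy_cross mu nu < +oo.

Definition energy mu nu : \bar R := energy_like mu nu - energy_cross mu nu.

Definition strictly_positive_definite : Prop :=
  forall mu, energy_defined mu mu ->
    0 <= energy mu mu /\ (mu <> 0%R -> 0 < energy mu mu).

Definition finite_energy : set (signedRadon R X) := [set mu |
  [/\ energy_pos (pos_part mu) (pos_part mu) < +oo,
      energy_pos (neg_part mu) (neg_part mu) < +oo
    & energy_pos (pos_part mu) (neg_part mu) < +oo]].

Definition knorm mu : R := Num.sqrt (fine (energy mu mu)).

Definition kdist mu nu : R := knorm (mu - nu)%R.

Definition positive_radon mu : Prop := forall B, (0 <= mu B)%R.

(* A positive [mu] is equal to its positive part, which is a measure defined on
   all Borel sets. *)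
Definition finite_energy_pos Q : set (signedRadon R X) := [set mu |
  [/\ finite_energy mu, positive_radon mu
    & (pos_part mu).-negligible (~` Q : set (borel X))]].

Definition capacity Q : \bar R :=
  (ereal_inf [set energy mu mu |
    mu in [set mu | finite_energy_pos Q mu /\ pos_part mu Q = 1]])^-1.

End energy.

Section condensers.
Context {R : realType} {X : ptopologicalType} {I : finType}.
Local Open Scope ring_scope.

Definition generalized_condenser (A : I -> set X) (s : I -> R) : Prop :=
  [/\ (0 < #|I|)%N,
      forall i, A i !=set0 /\ locally_closed (A i),
      forall i, s i = 1 \/ s i = -1
    & forall i j, s i * s j = -1 -> A i `&` A j = set0].

Definition vector_measures (kappa : X -> X -> \bar R) (A : I -> set X) :
    set (I -> signedRadon R X) :=
  [set mu | forall i, finite_energy_pos kappa (A i) (mu i)].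

Definition Rmap (s : I -> R) (mu : I -> signedRadon R X) : signedRadon R X :=
  \sum_(i : I) s i *: mu i.

Definition vector_dist (kappa : X -> X -> \bar R) (s : I -> R)
    (mu nu : I -> signedRadon R X) : R :=
  knorm kappa (Rmap s mu - Rmap s nu).

Definition essentially_disjoint (kappa : X -> X -> \bar R)
    (A : I -> set X) : Prop :=
  forall i j, i != j -> capacity kappa (A i `&` A j) = 0%E.

End condensers.

(* Main.v *)
(** Two positive measures [m], [n] of finite energy have finite mutual energy:
    [m = p + w] and [n = q + w] with [p], [q] the Jordan parts of [m - n], the
    energy of [p] with [q] is finite because [p - q] has nonnegative energy, and
    the other terms are dominated by the energies of [m] and [n]. Hence the
    energy is a positive definite bilinear form on the differences of such
    measures, which contain [Rmap s mu - Rmap s nu]; this gives the semimetric,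
    and [d mu nu = 0] if and only if [Rmap s mu = Rmap s nu].

    A measure of finite energy does not charge sets of capacity zero. If the
    plates are essentially disjoint, [mu i] is therefore carried by the part of
    [A i] outside the other plates, and [Rmap s mu] restricted to this part is
    [s i *: mu i]. Conversely, a unit measure [tau] of finite energy on
    [A i `&` A j] forces [s i = s j], and putting [tau] on plate [i] or on
    plate [j] gives two distinct vectors with the same image. *)
Require Import Defs.
From HB Require Import structures.
From mathcomp Require Import all_boot all_order all_algebra.
From mathcomp Require Import ring lra.
From mathcomp Require Import finmap.
From mathcomp Require Import all_classical all_reals all_analysis.
From mathcomp Require Import measurable_realfun.
Set Implicit Arguments.
Unset Strict Implicit.
Unset Printing Implicit Defensive.
Import Order.TTheory GRing.Theory Num.Theory.
Import numFieldNormedType.Exports.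
Local Open Scope classical_set_scope.
Local Open Scope ring_scope.

(** * Measurability of the kernel *)

(** An injection [f] of [D] into [nat] regroups the union by the value of [f]. Each group is empty
    or a single [F i], so a sequence of measurable sets remains. *)
Lemma countable_bigcup_measurable d (T : measurableType d) (U : Type)
    (D : set U) (F : U -> set T) : countable D ->
  (forall i, D i -> measurable (F i)) -> measurable (\bigcup_(i in D) F i).
Proof.
move=> /countable_injP[f injf] mF.
have -> : \bigcup_(i in D) F i =
    \bigcup_n \bigcup_(i in D `&` [set i | f i = n]) F i.
  apply/seteqP; split=> [x [i Di Fix]|x [n _ [i [Di _] Fix]]]; last by exists i.
  by exists (f i) => //; exists i.
apply: bigcupT_measurable => n.
have [[i [Di fin]]|nD] := pselect (exists i, D i /\ f i = n).
  rewrite (_ : D `&` _ = [set i]) ?bigcup_set1; first exact: mF.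
  apply/seteqP; split=> [j [Dj fjn]|_ ->] //.
  by apply: injf; rewrite ?inE// fin.
rewrite (_ : D `&` _ = set0) ?bigcup_set0//.
by rewrite -subset0 => i Di; apply: nD; exists i.
Qed.

Section topology.
Context {R : realType} {X : ptopologicalType}.

(** For each radius [n.+1%:R^-1], every compact [K k] is covered by finitely many balls of that
    radius. All these balls together form a countable base. *)
Lemma metrizable_second_countable :
  metrizable R X -> countable_at_infinity X -> @second_countable X.
Proof.
move=> [d [[[d0 dxx dC dT] _] nbhsE]] [K [cK KT]].
pose f n x : set X := [set y | d x y < n.+1%:R^-1].
have fo n x : open (f n x).
  rewrite openE => y /= xy; apply/nbhsE.
  exists (n.+1%:R^-1 - d x y); first by rewrite subr_gt0.
  by move=> z /=; rewrite ltrBrDl; apply: le_lt_trans; exact: dT.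
have h n k : exists D : {fset X}, K k `<=` \bigcup_(x in [set` D]) f n x.
  have := cK k; rewrite compact_cover.
  move=> /(_ X setT (f n) (fun x _ => fo n x)) [].
    by move=> x _; exists x => //; rewrite /f /= dxx// invr_gt0.
  by move=> D _ KD; exists D.
have [D hD] : exists D : nat -> nat -> {fset X},
    forall n k, K k `<=` \bigcup_(x in [set` D n k]) f n x.
  have /choice[D hD] : forall nk : nat * nat, exists D : {fset X},
      K nk.2 `<=` \bigcup_(x in [set` D]) f nk.1 x by move=> nk; exact: h.
  by exists (fun n k => D (n, k)) => n k; exact: (hD (n, k)).
exists (\bigcup_n \bigcup_k (f n @` [set` D n k])); last split.
- apply: bigcup_countable => // n _; apply: bigcup_countable => // k _.
  exact/finite_set_countable/finite_image/finite_fset.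
- by move=> _ [n _ [k _ [x _ <-]]].
- move=> x V /nbhsE[e e0 eV].
  (* A ball of radius below [e / 2] that contains [x] lies in the ball of radius [e] around [x]. *)
  have [|N] := @ltr_add_invr R 0 (e / 2) _; first by rewrite divr_gt0.
  rewrite add0r => Ne.
  have : [set: X] x by [].
  rewrite -KT => -[k _ Kx].
  have [w Dw fx] := hD N k x Kx.
  exists (f N w); first by split=> //; exists N => //; exists k => //; exists w.
  move=> z wz; apply: eV => /=; apply: (le_lt_trans (dT x w z I I I)).
  rewrite [ltRHS]splitr ltrD//.
    by rewrite (dC x w I I); exact: lt_trans Ne.
  exact: lt_trans Ne.
Qed.

(** Tonelli's theorem uses the product of the two Borel sigma-algebras, which a countable base makes
    large enough: [U] is the union of the countably many basic rectangles inside it. *)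
Lemma open_prod_measurable (U : set (X * X)) : @second_countable X ->
  open U -> measurable (U : set (borel X * borel X)).
Proof.
move=> [B cB [Bo Bb]] oU.
have -> : U = \bigcup_(P in (B `*` B) `&` [set P | P.1 `*` P.2 `<=` U])
    (P.1 `*` P.2).
  apply/seteqP; split=> [[x y] Uxy|[x y] [P [_]]]; last exact.
  have : nbhs (x, y) U by exact: open_nbhs_nbhs.
  move=> [[V W] [/= /Bb[V' [BV' V'x] V'V] /Bb[W' [BW' W'y] W'W]] VWU].
  exists (V', W') => //; split=> //= -[x' y'] [/= /V'V ? /W'W ?].
  exact: VWU.
apply: countable_bigcup_measurable => [|P [[BP1 BP2] _]].
  apply: sub_countable (countableX cB cB).
  by apply: subset_card_le; exact: subIsetl.
by apply: measurableX; apply: sub_sigma_algebra; exact: Bo.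
Qed.

(** Lower semicontinuity makes the sets where the kernel exceeds a real [a] open, and these rays
    generate the sigma-algebra of the extended reals. *)
Lemma kernel_measurable (kappa : X -> X -> \bar R) : @second_countable X ->
  is_kernel kappa ->
  measurable_fun setT
    ((fun z => kappa z.1 z.2) : borel X * borel X -> \bar R).
Proof.
move=> scX [_ _ lsc]; apply: (measurability _ (ErealGenOInfty.measurableE R)).
move=> /= _ [_ [a ->]] <-; apply: measurableI => //.
apply: open_prod_measurable => //.
by rewrite preimage_itvoy; move/lower_semicontinuousP : lsc; exact.
Qed.

End topology.

(** * Signed Radon measures *)

Section exhaustion.
Context {X : ptopologicalType}.

(** A signed Radon measure has meaningful values only on bounded Borel sets. Such a partition lets
    global facts be assembled from bounded pieces. *)
Definition bounded_partition (B : (set X)^nat) : Prop :=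
  [/\ forall n, bounded_borel (B n), trivIset setT B & \bigcup_n B n = setT].

Lemma closed_borel (F : set X) : closed F -> measurable (F : set (borel X)).
Proof.
move=> cF; rewrite -(setCK F); apply: measurableC.
by apply: sub_sigma_algebra; exact: closed_openC.
Qed.

Lemma compact_bounded_borel (K : set X) :
  hausdorff_space X -> compact K -> bounded_borel K.
Proof.
move=> hX cK; split; first exact: compact_precompact.
by apply: closed_borel; exact: compact_closed.
Qed.

Lemma bounded_borelS (A B : set X) : bounded_borel B ->
  measurable (A : set (borel X)) -> A `<=` B -> bounded_borel A.
Proof. by move=> bB mA /setIidr <-; exact: bounded_borelI. Qed.

Lemma bounded_partition_exists : hausdorff_space X ->
  countable_at_infinity X -> exists B, bounded_partition B.
Proof.
move=> hX [K [cK KT]]; exists (seqDU K); split.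
- move=> n; apply: (bounded_borelS (compact_bounded_borel hX (cK n))).
    apply: measurableD; first by case: (compact_bounded_borel hX (cK n)).
    apply: bigsetU_measurable => i _.
    by case: (compact_bounded_borel hX (cK i)).
  exact: subset_seqDU.
- exact: trivIset_seqDU.
- by rewrite -seqDU_bigcup_eq.
Qed.

End exhaustion.

(** * Operations on signed Radon measures: linear structure, restriction, null sets *)

Section radon.
Context {R : realType} {X : ptopologicalType}.
Implicit Types (mu nu m n p q : signedRadon R X) (C D P : set X).

Lemma radon_eq mu nu : (forall C, bounded_borel C -> mu C = nu C) -> mu = nu.
Proof.
move=> h; apply/val_inj/funext => C /=.
have [bC|nC] := pselect (bounded_borel C); first exact: h.
by have [-> // _ _] := signed_radonP mu; have [-> // _ _] := signed_radonP nu.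
Qed.

Lemma radonD mu nu C : (mu + nu) C = mu C + nu C. Proof. by []. Qed.

Lemma radonZ a mu C : (a *: mu) C = a * mu C. Proof. by []. Qed.

Lemma radonN mu C : (- mu) C = - mu C. Proof. by []. Qed.

Lemma radonB mu nu C : (mu - nu) C = mu C - nu C. Proof. by []. Qed.

Lemma radon_sum (I : finType) (f : I -> signedRadon R X) C :
  (\sum_i f i) C = \sum_i f i C.
Proof.
by apply: (big_morph (fun mu : signedRadon R X => mu C)) => // *;
  exact: radonD.
Qed.

Lemma radon_splitI mu C D : bounded_borel C -> measurable (D : set (borel X)) ->
  mu C = mu (C `&` D) + mu (C `\` D).
Proof.
move=> bC mD; rewrite -{1}(setUIDK C D) signed_radonU//.
- exact: bounded_borelI.
- by apply: bounded_borelI => //; exact: measurableC.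
- by rewrite setDE setIACA setICr setI0.
Qed.

(** The test is on [C] because its intersection with [D] may be bounded when [C] is not, and the
    value must be 0 there. A compact set that approximates the intersection also serves for [C]. *)
Lemma is_signed_radon_restr mu D : measurable (D : set (borel X)) ->
  (fun C => if `[< bounded_borel C >] then mu (C `&` D) else 0)
    \in @signed_radon_pred R X.
Proof.
move=> mD; apply/asboolP; have [mu0 muS muK] := signed_radonP mu; split.
- by move=> C nC; case: asboolP.
- move=> F bF tF bU; rewrite asboolT//.
  under eq_fun do under eq_bigr do rewrite asboolT//.
  rewrite setI_bigcupl; apply: muS.
  + by move=> n; exact: bounded_borelI.
  + exact: trivIset_setIr.
  + by rewrite -setI_bigcupl; exact: bounded_borelI.
- move=> C bC e e0.
  have [K [cK KCD] HK] := muK _ (bounded_borelI bC mD) _ e0.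
  exists K; first by split=> // x /KCD[].
  move=> E bE EC; rewrite asboolT//; apply: HK; first exact: bounded_borelI.
  by move=> x [/EC[Cx nKx] Dx].
Qed.

Definition radon_restr D (mD : measurable (D : set (borel X))) mu :=
  SignedRadon (is_signed_radon_restr mu mD).

Lemma radon_restrE D (mD : measurable (D : set (borel X))) mu C :
  bounded_borel C -> radon_restr mD mu C = mu (C `&` D).
Proof. by move=> bC; rewrite /= asboolT. Qed.

Lemma positive_radonP mu :
  (forall C, bounded_borel C -> 0 <= mu C) -> positive_radon mu.
Proof.
move=> h C; have [bC|nC] := pselect (bounded_borel C); first exact: h.
by have [-> // _ _] := signed_radonP mu.
Qed.

Lemma positive_radonD mu nu :
  positive_radon mu -> positive_radon nu -> positive_radon (mu + nu).
Proof. by move=> pmu pnu C; rewrite radonD addr_ge0. Qed.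

Lemma positive_radonZ a mu :
  0 <= a -> positive_radon mu -> positive_radon (a *: mu).
Proof. by move=> a0 pmu C; rewrite radonZ mulr_ge0. Qed.

Lemma positive_radon0 : positive_radon (0 : signedRadon R X).
Proof. by []. Qed.

Lemma positive_radon_restr D (mD : measurable (D : set (borel X))) mu :
  positive_radon mu -> positive_radon (radon_restr mD mu).
Proof. by move=> pmu; apply: positive_radonP => C bC; rewrite radon_restrE. Qed.

Lemma positive_radon_le mu C D : positive_radon mu -> bounded_borel D ->
  bounded_borel C -> C `<=` D -> mu C <= mu D.
Proof.
move=> pmu bD [_ mC] CD.
by rewrite (radon_splitI mu bD mC) (setIidr CD) lerDl.
Qed.

Lemma pos_part_bounded mu C : positive_radon mu -> bounded_borel C ->
  (pos_part mu C = (mu C)%:E)%E.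
Proof.
move=> pmu bC; apply/eqP; rewrite eq_le; apply/andP; split.
  apply: ge_ereal_sup => _ [D [bD DC] <-]; rewrite lee_fin.
  exact: (positive_radon_le pmu bC bD).
by apply: ereal_sup_ubound; exists C => //; split.
Qed.

Lemma pos_part_0 (D : set (borel X)) :
  pos_part (0 : signedRadon R X) D = 0%E.
Proof.
apply/eqP; rewrite eq_le measure_ge0 andbT.
by apply: ge_ereal_sup => _ [C _ <-].
Qed.

(** The sets [F j] are cut out of [C] one after the other, each cut removing a part of measure 0,
    until nothing is left. *)
Lemma radon_cover0 mu (I : eqType) (F : I -> set X) (s : seq I) C :
  (forall j, measurable (F j : set (borel X))) ->
  (forall j D, bounded_borel D -> D `<=` F j -> mu D = 0) ->
  bounded_borel C -> (forall x, C x -> exists2 j, j \in s & F j x) -> mu C = 0.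
Proof.
move=> mF muF; elim: s C => [|j s ih] C bC CF.
  rewrite (_ : C = set0) ?signed_radon0// -subset0 => x /CF[j].
  by rewrite in_nil.
rewrite (radon_splitI mu bC (mF j)) (muF j) ?add0r; last 2 first.
- exact: bounded_borelI.
- exact: subIsetr.
apply: ih; first by apply: bounded_borelI => //; exact: measurableC.
move=> x [/CF[k]]; rewrite inE => /orP[/eqP -> //|ks Fx _].
by exists k.
Qed.

Lemma negligible_radon0 mu Q C : positive_radon mu ->
  (pos_part mu).-negligible (Q : set (borel X)) ->
  bounded_borel C -> C `<=` Q -> mu C = 0.
Proof.
move=> pmu nQ bC CQ; apply: EFin_inj; rewrite -pos_part_bounded//.
apply: (iffLR (negligibleP _ _)); first by case: bC.
exact: negligibleS nQ.
Qed.

End radon.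

(** * Hahn decomposition on a bounded Borel set *)

Section radon_charge.
Context {R : realType} {X : ptopologicalType}.
Variables (mu : signedRadon R X) (B : set X) (bB : bounded_borel B).
Local Open Scope ereal_scope.

(** This is [mu] restricted to [B], finite on all Borel sets. Taking the proof of boundedness as an
    argument lets the charge structure depend on it. *)
Definition radon_charge of bounded_borel B : set (borel X) -> \bar R :=
  fun A => (mu (A `&` B))%:E.

Let radon_charge0 : radon_charge bB set0 = 0.
Proof. by rewrite /radon_charge set0I signed_radon0. Qed.

Let radon_charge_fin A : measurable A -> radon_charge bB A \is a fin_num.
Proof. by []. Qed.

Let radon_charge_sigma_additive : semi_sigma_additive (radon_charge bB).
Proof.
move=> F mF tF mU; rewrite /radon_charge.
under eq_fun do rewrite sumEFin.
apply: cvg_EFin; first exact: nearW.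
have [_ muS _] := signed_radonP mu.
rewrite /comp /= setI_bigcupl; apply: muS.
- by move=> n; rewrite setIC; exact: bounded_borelI.
- exact: trivIset_setIr.
- by rewrite -setI_bigcupl setIC; exact: bounded_borelI.
Qed.

HB.instance Definition _ := isCharge.Build _ _ _ (radon_charge bB)
  radon_charge0 radon_charge_fin radon_charge_sigma_additive.

Lemma radon_hahn_bounded : exists2 P : set X, measurable (P : set (borel X)) &
  (forall C, bounded_borel C -> C `<=` B `&` P -> (0 <= mu C)%R) /\
  (forall C, bounded_borel C -> C `<=` B `\` P -> (mu C <= 0)%R).
Proof.
have [P [N [[mP hP] [mN hN] PN _]]] := Hahn_decomposition (radon_charge bB).
exists P => //; split=> C [_ mC] CB.
- have /(hP _ mC) : C `<=` P by move=> x /CB[].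
  by rewrite /radon_charge /= lee_fin setIidl// => x /CB[].
- have /(hN _ mC) : C `<=` N.
    by move=> x /CB[_ nPx]; have : [set: X] x by []; rewrite -PN => -[].
  by rewrite /radon_charge /= lee_fin setIidl// => x /CB[].
Qed.

End radon_charge.

(** * Hahn and Jordan decompositions on the whole space *)

Section jordan.
Context {R : realType} {X : ptopologicalType} {B : (set X)^nat}.
Hypothesis hB : bounded_partition B.
Implicit Types (mu nu m n p q : signedRadon R X) (C D P : set X).

Lemma radon_cvg mu C : bounded_borel C ->
  \sum_(0 <= i < k) mu (C `&` B i) @[k --> \oo] --> mu C.
Proof.
move=> bC; have [bB tB BT] := hB; have [_ muS _] := signed_radonP mu.
have CE : \bigcup_n (C `&` B n) = C by rewrite -setI_bigcupr BT setIT.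
rewrite -[X in _ --> mu X]CE; apply: muS.
- by move=> n; apply: bounded_borelI => //; case: (bB n).
- exact: trivIset_setIl.
- by rewrite CE.
Qed.

Lemma radon_ge0_partition mu C : bounded_borel C ->
  (forall i, 0 <= mu (C `&` B i)) -> 0 <= mu C.
Proof.
move=> bC h; rewrite -(cvg_lim _ (radon_cvg bC))//.
apply: limr_ge; first by apply/cvg_ex; exists (mu C); exact: radon_cvg.
by apply: nearW => k; exact: sumr_ge0.
Qed.

(** The Hahn sets [P i] of the restrictions to the pieces [B i] are glued. Disjointness of the
    pieces makes the glued set coincide with [P i] inside [B i]. *)
Lemma radon_hahn mu : exists2 P : set X, measurable (P : set (borel X)) &
  (forall C, bounded_borel C -> C `<=` P -> 0 <= mu C) /\
  (forall C, bounded_borel C -> C `<=` ~` P -> mu C <= 0).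
Proof.
have [bB tB BT] := hB.
have /choice[P hP] : forall i, exists P : set X,
    measurable (P : set (borel X)) /\
    ((forall C, bounded_borel C -> C `<=` B i `&` P -> 0 <= mu C) /\
    (forall C, bounded_borel C -> C `<=` B i `\` P -> mu C <= 0)).
  by move=> i; have [P ? ?] := radon_hahn_bounded mu (bB i); exists P.
have mP i : measurable (P i : set (borel X)) by case: (hP i).
have mB i : measurable (B i : set (borel X)) by case: (bB i).
exists (\bigcup_i (B i `&` P i)).
  by apply: bigcupT_measurable => i; exact: measurableI.
split=> C bC CP.
- apply: radon_ge0_partition => // i; apply: (proj1 (proj2 (hP i))).
    exact: bounded_borelI.
  move=> x [/CP[j _ [Bjx Pjx]] Bix]; suff <- : j = i by [].
  by apply: tB => //; exists x.
- rewrite -oppr_ge0 -radonN; apply: radon_ge0_partition => // i.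
  rewrite radonN oppr_ge0; apply: (proj2 (proj2 (hP i))).
    exact: bounded_borelI.
  move=> x [/CP nP Bix]; split=> // Pix; apply: nP; exists i => //.
Qed.

(** With [P] a Hahn set, [p] is [mu] restricted to [P] and [n] is [- mu] restricted to its
    complement. The last clause is minimality: [p] is the least positive measure above [mu], and [n]
    the least above [- mu]. *)
Lemma radon_jordan mu : exists p n, [/\ positive_radon p /\ positive_radon n,
  mu = p - n, pos_part mu = pos_part p, neg_part mu = pos_part n &
  (forall m, positive_radon m -> positive_radon (m - mu) ->
    positive_radon (m - p)) /\
  (forall m, positive_radon m -> positive_radon (m + mu) ->
    positive_radon (m - n))].
Proof.
have [P mP [hP hN]] := radon_hahn mu.
have mP' : measurable (~` P : set (borel X)) by exact: measurableC.
have bIP C : bounded_borel C -> bounded_borel (C `&` P).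
  by move=> bC; exact: bounded_borelI.
have bDP C : bounded_borel C -> bounded_borel (C `\` P).
  by move=> bC; exact: bounded_borelI.
pose p := radon_restr mP mu; pose n := radon_restr mP' (- mu).
have pE C : bounded_borel C -> p C = mu (C `&` P) by exact: radon_restrE.
have nE C : bounded_borel C -> n C = - mu (C `\` P).
  by move=> bC; rewrite radon_restrE// radonN setDE.
have pp : positive_radon p.
  by apply: positive_radonP => C bC; rewrite pE// hP//; exact: bIP.
have pn : positive_radon n.
  apply: positive_radonP => C bC; rewrite nE// oppr_ge0.
  apply: hN; first exact: bDP.
  by move=> x [].
have muE : mu = p - n.
  apply: radon_eq => C bC.
  by rewrite radonB pE// nE// opprK; exact: radon_splitI.
exists p, n; split => //.
- apply/funext => C; apply/eqP; rewrite eq_le; apply/andP; split.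
    apply: ge_ereal_sup => _ [D [bD DC] <-].
    apply: (@le_trans _ _ (p D)%:E); last by apply: ereal_sup_ubound; exists D.
    by rewrite lee_fin muE radonB gerBl.
  (* The value [p D] is attained by [mu] on the part of [D] inside [P], which competes in the
     supremum for [mu]. *)
  apply: ge_ereal_sup => _ [D [bD DC] <-]; rewrite pE//.
  apply: ereal_sup_ubound; exists (D `&` P) => //; split; first exact: bIP.
  by apply: subset_trans DC; exact: subIsetl.
- apply/funext => C; apply/eqP; rewrite eq_le; apply/andP; split.
    apply: ge_ereal_sup => _ [D [bD DC] <-].
    apply: (@le_trans _ _ (n D)%:E); last by apply: ereal_sup_ubound; exists D.
    by rewrite lee_fin muE opprB radonB gerBl.
  apply: ge_ereal_sup => _ [D [bD DC] <-]; rewrite nE//.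
  apply: ereal_sup_ubound; exists (D `\` P) => //; split; first exact: bDP.
  by apply: subset_trans DC; exact: subIsetl.
- split=> m pm hm; apply: positive_radonP => C bC; rewrite radonB.
  + rewrite pE// (radon_splitI m bC mP) addrAC addr_ge0//.
    by have := hm (C `&` P); rewrite radonB.
  + rewrite nE// opprK (radon_splitI m bC mP) -addrA addr_ge0//.
    exact: (hm (C `\` P)).
Qed.

Section pos_part.
Local Open Scope ereal_scope.

(** Both sides are countably additive and agree on the bounded pieces of [D]. This identifies the
    measure of a sum, a multiple or a restriction. *)
Lemma pos_part_unique (m : {measure set (borel X) -> \bar R}) mu :
  positive_radon mu -> (forall C, bounded_borel C -> m C = (mu C)%:E) ->
  forall D : set (borel X), measurable D -> pos_part mu D = m D.
Proof.
move=> pmu mE D mD; have [bB tB BT] := hB.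
have mDB i : measurable (D `&` B i : set (borel X)).
  by apply: measurableI => //; case: (bB i).
have tDB : trivIset setT (fun i => D `&` B i) by exact: trivIset_setIl.
have DE : D = \bigcup_i (D `&` B i) by rewrite -setI_bigcupr BT setIT.
have mDU : measurable (\bigcup_i (D `&` B i) : set (borel X)) by rewrite -DE.
rewrite DE !measure_semi_bigcup//; apply: eq_eseriesr => i _.
have bDB : bounded_borel (D `&` B i) by apply: (bounded_borelS (bB i)).
by rewrite mE// -pos_part_bounded.
Qed.

Lemma pos_partD mu nu (D : set (borel X)) :
  positive_radon mu -> positive_radon nu ->
  measurable D -> pos_part (mu + nu)%R D = pos_part mu D + pos_part nu D.
Proof.
move=> pmu pnu mD; rewrite -(measure_addE (pos_part mu) (pos_part nu) D).
apply: pos_part_unique => //; first exact: positive_radonD.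
move=> C bC; rewrite [LHS](measure_addE (pos_part mu) (pos_part nu) C) /=.
by rewrite !pos_part_bounded.
Qed.

Lemma pos_partZ (a : {nonneg R}) mu (D : set (borel X)) : positive_radon mu ->
  measurable D -> pos_part (a%:num *: mu)%R D = a%:num%:E * pos_part mu D.
Proof.
move=> pmu mD; rewrite -[RHS]/(mscale a (pos_part mu) D).
apply: pos_part_unique => //; first exact: positive_radonZ.
by move=> C bC; rewrite -[LHS]/(a%:num%:E * pos_part mu C) pos_part_bounded.
Qed.

Lemma pos_part_restr E (mE : measurable (E : set (borel X))) mu
    (D : set (borel X)) : positive_radon mu ->
  measurable D -> pos_part (radon_restr mE mu) D = pos_part mu (D `&` E).
Proof.
move=> pmu mD; rewrite -[RHS]/(mrestr (pos_part mu) mE D).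
apply: pos_part_unique => //; first exact: positive_radon_restr.
move=> C bC; rewrite -[LHS]/(pos_part mu (C `&` E)).
rewrite pos_part_bounded//; last exact: bounded_borelI.
by rewrite radon_restrE.
Qed.

Lemma pos_part_sigma_finite mu :
  positive_radon mu -> sigma_finite setT (pos_part mu).
Proof.
move=> pmu; have [bB tB BT] := hB; exists B => // i; split.
  by case: (bB i).
by rewrite pos_part_bounded// ltry.
Qed.

End pos_part.
End jordan.

(** * Energy of positive measures *)

Section energy.
Context {R : realType} {X : ptopologicalType} {B : (set X)^nat}.
Variable kappa : X -> X -> \bar R.
Hypothesis hB : bounded_partition B.
Hypothesis scX : @second_countable X.
Hypothesis hk : is_kernel kappa.
Implicit Types (mu nu m n p q : signedRadon R X) (C D P : set X).

Local Notation EE m n := (energy_pos kappa (pos_part m) (pos_part n)).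

Section positive.
Local Open Scope ereal_scope.

(** Tonelli's theorem expects a bundled sigma-finite measure. Positivity of [m] is a hypothesis, so
    the bundle is produced by an existence statement. *)
Lemma pos_part_sigma_finite_measure m : positive_radon m ->
  exists m' : {sigma_finite_measure set (borel X) -> \bar R},
    (m' : set (borel X) -> \bar R) = pos_part m.
Proof.
move=> pm; have sm := pos_part_sigma_finite hB pm.
pose i := @Measure_isSigmaFinite.Build _ _ _ (pos_part m) sm.
by exists (HB.pack_for {sigma_finite_measure set (borel X) -> \bar R}
  (pos_part m) i).
Qed.

(** Jordan parts are identified as set functions, whereas [energy_pos] takes bundled measures; this
    passes from one to the other. *)
Lemma eq_energy_pos (m1 m2 n1 n2 : {measure set (borel X) -> \bar R}) :
  m1 =1 m2 -> n1 =1 n2 -> energy_pos kappa m1 n1 = energy_pos kappa m2 n2.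
Proof.
move=> m12 n12; rewrite /energy_pos (eq_measure_integral n2)//.
by apply: eq_integral => y _; exact: eq_measure_integral.
Qed.

Lemma energy_like_jordan mu nu p q p' q' :
  pos_part mu = pos_part p -> pos_part nu = pos_part p' ->
  neg_part mu = pos_part q -> neg_part nu = pos_part q' ->
  energy_like kappa mu nu = EE p p' + EE q q'.
Proof.
by move=> pE pE' nE nE'; congr (_ + _); apply: eq_energy_pos => D /=;
  rewrite ?pE ?pE' ?nE ?nE'.
Qed.

Lemma energy_cross_jordan mu nu p q p' q' :
  pos_part mu = pos_part p -> pos_part nu = pos_part p' ->
  neg_part mu = pos_part q -> neg_part nu = pos_part q' ->
  energy_cross kappa mu nu = EE p q' + EE q p'.
Proof.
by move=> pE pE' nE nE'; congr (_ + _); apply: eq_energy_pos => D /=;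
  rewrite ?pE ?pE' ?nE ?nE'.
Qed.

Lemma kernel_ge0 x y : 0 <= kappa x y. Proof. by case: hk. Qed.

Lemma energy_pos_ge0 (m n : {measure set (borel X) -> \bar R}) :
  0 <= energy_pos kappa m n.
Proof.
by apply: integral_ge0 => y _; apply: integral_ge0 => x _; exact: kernel_ge0.
Qed.

Lemma potential_measurable m : positive_radon m ->
  measurable_fun setT
    ((fun y => \int[pos_part m]_x kappa x y) : borel X -> \bar R).
Proof.
move=> /pos_part_sigma_finite_measure[m' <-].
by have := @measurable_fun_fubini_tonelli_G _ _ _ (borel X) _ m'
  (fun z => kappa z.1 z.2) (kernel_measurable scX hk)
  (fun z => kernel_ge0 z.1 z.2); exact.
Qed.

Lemma potential_ge0 m y : 0 <= \int[pos_part m]_x kappa x y.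
Proof. by apply: integral_ge0 => x _; exact: kernel_ge0. Qed.

(** Tonelli's theorem exchanges the integrals and the symmetry of the kernel does the rest.
    Linearity and monotonicity are then proved in one argument and transferred to the other. *)
Lemma energy_posC m n : positive_radon m -> positive_radon n ->
  EE m n = EE n m.
Proof.
move=> pm pn; rewrite /energy_pos.
have [m' m'E] := pos_part_sigma_finite_measure pm.
have [n' n'E] := pos_part_sigma_finite_measure pn.
have := @fubini_tonelli _ _ _ _ _ m' n' (fun z => kappa z.1 z.2)
  (kernel_measurable scX hk) (fun z => kernel_ge0 z.1 z.2).
rewrite m'E n'E /= => <-; apply: eq_integral => x _.
by apply: eq_integral => y _; case: hk.
Qed.

Lemma energy_posDr m n p : positive_radon m -> positive_radon n ->
  positive_radon p -> EE m (n + p)%R = EE m n + EE m p.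
Proof.
move=> pm pn pp; rewrite /energy_pos.
rewrite -ge0_integral_measure_add//.
- apply: eq_measure_integral => D mD _.
  rewrite [RHS](measure_addE (pos_part n) (pos_part p) D).
  exact: (pos_partD hB).
- by move=> y _; exact: potential_ge0.
- exact: potential_measurable.
Qed.

Lemma energy_posZr (a : {nonneg R}) m n : positive_radon m ->
  positive_radon n -> EE m (a%:num *: n)%R = a%:num%:E * EE m n.
Proof.
move=> pm pn; rewrite /energy_pos -ge0_integral_mscale//.
- by apply: eq_measure_integral => D mD _; exact: (pos_partZ hB).
- exact: potential_measurable.
- by move=> y _; exact: potential_ge0.
Qed.

Lemma le_energy_posr m n p : positive_radon m -> positive_radon p ->
  positive_radon (n - p)%R -> EE m p <= EE m n.
Proof.
move=> pm pp pnp; rewrite -[in leRHS](subrK p n) energy_posDr// leeDr//.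
exact: energy_pos_ge0.
Qed.

Lemma le_energy_pos m n p q : positive_radon p -> positive_radon q ->
  positive_radon (m - p)%R -> positive_radon (n - q)%R -> EE p q <= EE m n.
Proof.
move=> pp pq pmp pnq.
have pm : positive_radon m by rewrite -(subrK p m); exact: positive_radonD.
have pn : positive_radon n by rewrite -(subrK q n); exact: positive_radonD.
apply: (@le_trans _ _ (EE p n)); first exact: le_energy_posr.
by rewrite energy_posC// (energy_posC pm pn); exact: le_energy_posr.
Qed.

End positive.

Hypothesis spd : strictly_positive_definite kappa.

(** A form of [finite_energy] for positive measures without Jordan parts; [finite_energy_posP]
    relates the two. *)
Definition finite_pos m := positive_radon m /\ (EE m m < +oo)%E.

Lemma finite_pos_le m p : finite_pos m -> positive_radon p ->
  positive_radon (m - p) -> finite_pos p.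
Proof.
move=> [pm fm] pp pmp; split=> //.
by apply: le_lt_trans fm; exact: le_energy_pos.
Qed.

(** Since [m] and [n] are positive measures above [m - n] and [n - m], minimality of the Jordan
    parts gives that [p] is below [m] and [q] below [n]. The common remainder is [w]. *)
Lemma energy_jordan m n : finite_pos m -> finite_pos n ->
  exists p q w, [/\ finite_pos p, finite_pos q, finite_pos w,
    m = p + w /\ n = q + w &
    pos_part (m - n) = pos_part p /\ neg_part (m - n) = pos_part q].
Proof.
move=> fm fn; have [pm _] := fm; have [pn _] := fn.
have [p [q [[pp pq] mnE posE negE [hp hq]]]] := radon_jordan hB (m - n).
have pmp : positive_radon (m - p) by apply: hp => //; rewrite subKr.
have pnq : positive_radon (n - q) by apply: hq => //; rewrite addrC subrK.
exists p, q, (m - p); split.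
- exact: finite_pos_le pmp.
- exact: finite_pos_le pnq.
- by apply: (finite_pos_le fm) => //; rewrite subKr.
- split; first by rewrite addrC subrK.
  by apply/eqP; rewrite addrCA -opprB -mnE opprB addrC subrK.
- by split.
Qed.

Lemma mutual_energy_fin m n : finite_pos m -> finite_pos n -> (EE m n < +oo)%E.
Proof.
move=> fm fn.
have [p [q [w [fp fq fw [mE nE] [posE negE]]]]] := energy_jordan fm fn.
have [pp _] := fp; have [pq _] := fq; have [pw _] := fw.
have fpq : (EE p q < +oo)%E.
  have like : (energy_like kappa (m - n)%R (m - n)%R < +oo)%E.
    rewrite (energy_like_jordan posE posE negE negE).
    by apply: lte_add_pinfty; [case: fp|case: fq].
  have [+ _] := spd (or_introl like).
  rewrite /energy; have := like.
  have : (0 <= energy_like kappa (m - n)%R (m - n)%R)%E.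
    by apply: adde_ge0; exact: energy_pos_ge0.
  have : (EE p q <= energy_cross kappa (m - n)%R (m - n)%R)%E.
    rewrite (energy_cross_jordan posE posE negE negE) leeDl//.
    exact: (energy_pos_ge0 (pos_part q) (pos_part p)).
  (* A finite cross term bounds [EE p q]. An infinite one would make the energy [-oo], against its
     nonnegativity. *)
  case: (energy_cross _ _ _) => [r| |].
  - by move=> /le_lt_trans + _ _ _; apply; rewrite ltry.
  - by case: (energy_like _ _ _).
  - by move=> /le_lt_trans + _ _ _; apply.
rewrite mE nE.
have pq_w := positive_radonD pp pw.
(* Of the four terms, the one of [q] and [w] is dominated by [EE n n] and the one of [w] and [p] by
   [EE m m]. *)
rewrite energy_posDr// !(energy_posC pq_w)// !energy_posDr//.
apply: lte_add_pinfty; apply: lte_add_pinfty; last by case: fw.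
- by rewrite energy_posC.
- case: (fn) => _; apply: le_lt_trans; apply: le_energy_pos => //.
    by rewrite nE addrC addKr.
  by rewrite nE addrK.
- case: (fm) => _; apply: le_lt_trans; apply: le_energy_pos => //.
    by rewrite mE addrK.
  by rewrite mE addrC addKr.
Qed.

Definition mutual m n := fine (EE m n).

Lemma mutualE m n : finite_pos m -> finite_pos n -> EE m n = (mutual m n)%:E.
Proof.
move=> fm fn; rewrite fineK// ge0_fin_numE; last exact: energy_pos_ge0.
exact: mutual_energy_fin.
Qed.

Lemma mutualC m n : finite_pos m -> finite_pos n -> mutual m n = mutual n m.
Proof. by move=> [pm _] [pn _]; rewrite /mutual energy_posC. Qed.

Lemma finite_posD m n : finite_pos m -> finite_pos n -> finite_pos (m + n).
Proof.
move=> fm fn; have [pm fm'] := fm; have [pn fn'] := fn.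
have pmn := positive_radonD pm pn; split=> //.
rewrite energy_posDr// !(energy_posC pmn)// !energy_posDr//.
apply: lte_add_pinfty; apply: lte_add_pinfty.
- exact: fm'.
- exact: (mutual_energy_fin fm fn).
- exact: (mutual_energy_fin fn fm).
- exact: fn'.
Qed.

Lemma finite_posZ a m : 0 <= a -> finite_pos m -> finite_pos (a *: m).
Proof.
move=> a0 [pm fm]; have pam := positive_radonZ a0 pm; split=> //.
rewrite -[a]/((NngNum a0)%:num) energy_posZr// energy_posC// energy_posZr//=.
by rewrite !lte_mul_pinfty//; apply: mule_ge0 => //; exact: energy_pos_ge0.
Qed.

Lemma energy_pos0r m : EE m 0 = 0%E.
Proof.
rewrite /energy_pos (eq_measure_integral mzero) ?integral_measure_zero//.
by move=> D _ _; exact: pos_part_0.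
Qed.

Lemma finite_pos0 : finite_pos 0.
Proof. by split; [exact: positive_radon0|rewrite energy_pos0r ltry]. Qed.

Lemma mutualDr m n p : finite_pos m -> finite_pos n -> finite_pos p ->
  mutual m (n + p) = mutual m n + mutual m p.
Proof.
move=> fm fn fp; apply: EFin_inj; rewrite EFinD -!mutualE//.
  by apply: energy_posDr; [case: fm|case: fn|case: fp].
exact: finite_posD.
Qed.

Lemma mutualDl m n p : finite_pos m -> finite_pos n -> finite_pos p ->
  mutual (n + p) m = mutual n m + mutual p m.
Proof.
move=> fm fn fp; rewrite mutualC//; last exact: finite_posD.
by rewrite mutualDr// (mutualC fm fn) (mutualC fm fp).
Qed.

Lemma mutualZr a m n : 0 <= a -> finite_pos m -> finite_pos n ->
  mutual m (a *: n) = a * mutual m n.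
Proof.
move=> a0 fm fn; apply: EFin_inj; rewrite EFinM -!mutualE//.
  by rewrite -[a]/((NngNum a0)%:num) energy_posZr//; [case: fm|case: fn].
exact: finite_posZ.
Qed.

Lemma mutualZl a m n : 0 <= a -> finite_pos m -> finite_pos n ->
  mutual (a *: m) n = a * mutual m n.
Proof.
move=> a0 fm fn; rewrite mutualC//; last exact: finite_posZ.
by rewrite mutualZr// mutualC.
Qed.

(** The energy is defined through Jordan parts, but any representation as a difference computes it:
    the common remainders [w] and [w'] cancel in the bilinear expansion. *)
Lemma energyBB m n m' n' : finite_pos m -> finite_pos n ->
  finite_pos m' -> finite_pos n' ->
  energy kappa (m - n) (m' - n') =
    (mutual m m' - mutual m n' - mutual n m' + mutual n n')%:E.
Proof.
move=> fm fn fm' fn'.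
have [p [q [w [fp fq fw [mE nE] [posE negE]]]]] := energy_jordan fm fn.
have [p' [q' [w' [fp' fq' fw' [m'E n'E] [posE' negE']]]]] :=
  energy_jordan fm' fn'.
rewrite /energy (energy_like_jordan posE posE' negE negE').
rewrite (energy_cross_jordan posE posE' negE negE') !mutualE//.
rewrite -!EFinD; congr _%:E.
rewrite mE nE m'E n'E !mutualDl ?mutualDr//; try exact: finite_posD.
(* Otherwise [ring] unfolds the integrals to compare its atoms. *)
do 9![move: (mutual _ _) => ?]; ring.
Qed.

End energy.

(** * The energy form *)

Section positive_form.
Context {R : realType} {V : lmodType R}.
Variables (D : V -> Prop) (b : V -> V -> R).
Hypothesis D0 : D 0.
Hypothesis DP : forall a u v, D u -> D v -> D (a *: u + v).
Hypothesis bC : forall u v, D u -> D v -> b u v = b v u.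
Hypothesis bPl : forall a u v w, D u -> D v -> D w ->
  b (a *: u + v) w = a * b u w + b v w.
Hypothesis b_ge0 : forall u, D u -> 0 <= b u u.
Hypothesis b_eq0 : forall u, D u -> b u u = 0 -> u = 0.

Lemma positive_form0l w : D w -> b 0 w = 0.
Proof.
move=> Dw; have := bPl 1 D0 D0 Dw.
rewrite scaler0 addr0 mul1r => /eqP.
by rewrite -subr_eq subrr eq_sym => /eqP.
Qed.

Lemma positive_formPP a u v : D u -> D v ->
  b (a *: u + v) (a *: u + v) = a ^+ 2 * b u u + a * b u v *+ 2 + b v v.
Proof.
move=> Du Dv; have Duv := DP a Du Dv.
rewrite bPl// (bC Du Duv) (bC Dv Duv) !bPl// (bC Dv Du); ring.
Qed.

(** Membership and the formula are proved together because each induction step applies linearity to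
    a partial sum, which must lie in [D]. *)
Lemma positive_form_sum (I : finType) (s : I -> R) (f : I -> V) w :
  (forall i, D (f i)) -> D w ->
  D (\sum_i s i *: f i) /\
  b (\sum_i s i *: f i) w = \sum_i s i * b (f i) w.
Proof.
move=> Df Dw; elim/big_rec2: _ => [|i c v _ [Dv <-]].
  by split => //; exact: positive_form0l.
by split; [exact: DP|exact: bPl].
Qed.

Lemma positive_form_cauchy_schwarz u v : D u -> D v ->
  b u v ^+ 2 <= b u u * b v v.
Proof.
move=> Du Dv; have [v0|v0] := eqVneq (b v v) 0.
  rewrite (b_eq0 Dv v0) (bC Du D0) (positive_form0l Du) (positive_form0l D0).
  by rewrite expr0n mulr0.
have vv : 0 < b v v by rewrite lt_def v0 b_ge0.
(* This coefficient minimizes the quadratic polynomial [b (a *: v + u) (a *: v + u)] in [a]. *)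
have := b_ge0 (DP (- (b u v / b v v)) Dv Du).
rewrite positive_formPP// (bC Dv Du) -(pmulr_rge0 _ vv) => h.
rewrite -subr_ge0; apply: le_trans h _.
by rewrite le_eqVlt; apply/orP; left; apply/eqP; field.
Qed.

Lemma positive_form_triangle u v : D u -> D v ->
  Num.sqrt (b (u + v) (u + v)) <= Num.sqrt (b u u) + Num.sqrt (b v v).
Proof.
move=> Du Dv.
rewrite -[leRHS]ger0_norm ?addr_ge0 ?sqrtr_ge0// -sqrtr_sqr ler_wsqrtr//.
rewrite -[u in leLHS]scale1r positive_formPP// sqrrD !sqr_sqrtr ?b_ge0//.
rewrite -sqrtrM ?b_ge0//.
have : b u v <= Num.sqrt (b u u * b v v).
  rewrite (le_trans (ler_norm _))// -sqrtr_sqr ler_wsqrtr//.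
  exact: positive_form_cauchy_schwarz.
lra.
Qed.

Lemma positive_formN u : D u -> b (- u) (- u) = b u u.
Proof.
move=> Du; rewrite -scaleN1r -[_ *: _]addr0 positive_formPP//.
by rewrite (bC Du D0) !positive_form0l// mulr0 mul0rn !addr0 sqrrN expr1n mul1r.
Qed.

End positive_form.

(** * The energy as an inner product, and null sets of capacity zero *)

Section energy_form.
Context {R : realType} {X : ptopologicalType} {B : (set X)^nat}.
Variable kappa : X -> X -> \bar R.
Hypothesis hB : bounded_partition B.
Hypothesis scX : @second_countable X.
Hypothesis hk : is_kernel kappa.
Hypothesis spd : strictly_positive_definite kappa.
Implicit Types (mu nu rho m n p q : signedRadon R X) (C D P Q : set X).

(** The subspace that serves as domain of the form. With arbitrary differences, closure under linear
    combinations needs no Jordan parts of the combination. *)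
Definition finite_diff mu := exists m n,
  [/\ finite_pos kappa m, finite_pos kappa n & mu = m - n].

Definition form mu nu := fine (energy kappa mu nu).

Lemma finite_pos_diff m : finite_pos kappa m -> finite_diff m.
Proof.
by move=> fm; exists m, 0; split => //; [exact: finite_pos0|rewrite subr0].
Qed.

Lemma finite_diff0 : finite_diff 0.
Proof. exact/finite_pos_diff/finite_pos0. Qed.

Lemma finite_diffP a mu nu : finite_diff mu -> finite_diff nu ->
  finite_diff (a *: mu + nu).
Proof.
move=> [m [n [fm fn ->]]] [m' [n' [fm' fn' ->]]].
have [a0|/ltW] := leP 0 a.
  exists (a *: m + m'), (a *: n + n').
  split; [| |by rewrite scalerBr opprD addrACA];
    by apply: (finite_posD hB) => //; exact: (finite_posZ hB).
(* Only nonnegative multiples of positive measures stay positive, so a negative [a] exchanges the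
   roles of [m] and [n]. *)
rewrite -oppr_ge0 => a0; exists (- a *: n + m'), (- a *: m + n').
split; [| |by rewrite scalerBr opprD !scaleNr opprK (addrC (a *: m)) addrACA];
  by apply: (finite_posD hB) => //; exact: (finite_posZ hB).
Qed.

Lemma finite_diffB mu nu : finite_diff mu -> finite_diff nu ->
  finite_diff (mu - nu).
Proof.
by move=> fmu fnu; rewrite addrC -scaleN1r; exact: finite_diffP.
Qed.

Lemma energy_fin mu nu : finite_diff mu -> finite_diff nu ->
  energy kappa mu nu \is a fin_num.
Proof.
by move=> [m [n [? ? ->]]] [m' [n' [? ? ->]]]; rewrite (energyBB hB).
Qed.

Lemma formBB m n m' n' : finite_pos kappa m -> finite_pos kappa n ->
  finite_pos kappa m' -> finite_pos kappa n' ->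
  form (m - n) (m' - n') = mutual kappa m m' - mutual kappa m n' -
    mutual kappa n m' + mutual kappa n n'.
Proof. by move=> *; rewrite /form (energyBB hB). Qed.

Lemma formC mu nu : finite_diff mu -> finite_diff nu -> form mu nu = form nu mu.
Proof.
move=> [m [n [fm fn ->]]] [m' [n' [fm' fn' ->]]]; rewrite !formBB//.
rewrite (mutualC hB scX hk fm fm') (mutualC hB scX hk fm fn').
rewrite (mutualC hB scX hk fn fm') (mutualC hB scX hk fn fn').
do 4![move: (mutual kappa _ _) => ?]; ring.
Qed.

Lemma formPl a mu nu rho :
  finite_diff mu -> finite_diff nu -> finite_diff rho ->
  form (a *: mu + nu) rho = a * form mu rho + form nu rho.
Proof.
move=> [m [n [fm fn ->]]] [m' [n' [fm' fn' ->]]] [r [t [fr ft ->]]].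
have fZ c x : 0 <= c -> finite_pos kappa x -> finite_pos kappa (c *: x).
  exact: (finite_posZ hB).
have fD x y : finite_pos kappa x -> finite_pos kappa y ->
    finite_pos kappa (x + y) by exact: (finite_posD hB).
have mDZ c x y z : 0 <= c -> finite_pos kappa x -> finite_pos kappa y ->
    finite_pos kappa z ->
    mutual kappa (c *: x + y) z = c * mutual kappa x z + mutual kappa y z.
  move=> c0 fx fy fz; rewrite (mutualDl hB scX hk spd fz (fZ _ _ c0 fx) fy).
  by rewrite (mutualZl hB scX hk spd c0 fx fz).
have [a0|/ltW] := leP 0 a.
  rewrite (_ : _ + _ = (a *: m + m') - (a *: n + n')); last first.
    by rewrite scalerBr opprD addrACA.
  have fam := fD _ _ (fZ _ _ a0 fm) fm'; have fan := fD _ _ (fZ _ _ a0 fn) fn'.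
  rewrite (formBB fam fan fr ft) (formBB fm fn fr ft) (formBB fm' fn' fr ft).
  rewrite (mDZ _ _ _ _ a0 fm fm' fr) (mDZ _ _ _ _ a0 fm fm' ft).
  rewrite (mDZ _ _ _ _ a0 fn fn' fr) (mDZ _ _ _ _ a0 fn fn' ft).
  do 8![move: (mutual kappa _ _) => ?]; ring.
rewrite -oppr_ge0 => a0.
rewrite (_ : _ + _ = (- a *: n + m') - (- a *: m + n')); last first.
  by rewrite scalerBr opprD !scaleNr opprK (addrC (a *: m)) addrACA.
have fan := fD _ _ (fZ _ _ a0 fn) fm'; have fam := fD _ _ (fZ _ _ a0 fm) fn'.
rewrite (formBB fan fam fr ft) (formBB fm fn fr ft) (formBB fm' fn' fr ft).
rewrite (mDZ _ _ _ _ a0 fn fm' fr) (mDZ _ _ _ _ a0 fn fm' ft).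
rewrite (mDZ _ _ _ _ a0 fm fn' fr) (mDZ _ _ _ _ a0 fm fn' ft).
do 8![move: (mutual kappa _ _) => ?]; ring.
Qed.

Lemma energy_defined_fin mu : finite_diff mu -> energy_defined kappa mu mu.
Proof.
move=> fmu; left; have := energy_fin fmu fmu.
rewrite /energy fin_numD => /andP[+ _].
by rewrite ge0_fin_numE//; apply: adde_ge0; exact: energy_pos_ge0.
Qed.

Lemma form_ge0 mu : finite_diff mu -> 0 <= form mu mu.
Proof.
by move=> fmu; apply: fine_ge0; have [] := spd (energy_defined_fin fmu).
Qed.

Lemma form_eq0 mu : finite_diff mu -> form mu mu = 0 -> mu = 0.
Proof.
move=> fmu f0; apply: contrapT => mu0.
have [_ /(_ mu0)] := spd (energy_defined_fin fmu).
by rewrite -(fineK (energy_fin fmu fmu)) -/(form mu mu) f0 ltxx.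
Qed.

(** The Jordan parts are dominated by [m] and [n], hence have finite energy, and their mutual energy
    is finite by [mutual_energy_fin]. *)
Lemma finite_diff_energy mu : finite_diff mu -> finite_energy kappa mu.
Proof.
move=> [m [n [fm fn ->]]].
have [p [q [w [fp fq fw _ [posE negE]]]]] := energy_jordan hB scX hk fm fn.
split.
- rewrite (@eq_energy_pos _ _ kappa _ (pos_part p) _ (pos_part p)).
  + by case: fp.
  + by move=> D /=; rewrite posE.
  + by move=> D /=; rewrite posE.
- rewrite (@eq_energy_pos _ _ kappa _ (pos_part q) _ (pos_part q)).
  + by case: fq.
  + by move=> D /=; rewrite negE.
  + by move=> D /=; rewrite negE.
- rewrite (@eq_energy_pos _ _ kappa _ (pos_part p) _ (pos_part q)).
  + exact: (mutual_energy_fin hB).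
  + by move=> D /=; rewrite posE.
  + by move=> D /=; rewrite negE.
Qed.

Lemma finite_energy_posP Q mu :
  finite_energy_pos kappa Q mu <-> finite_pos kappa mu /\
    (pos_part mu).-negligible (~` Q : set (borel X)).
Proof.
split=> [[[fmu _ _] pmu nmu]|[fmu nmu]]; first by split.
split => //; last by case: fmu.
exact/finite_diff_energy/finite_pos_diff.
Qed.

(** If [mu C] were nonzero, [mu] restricted to [C] and normalized to mass 1 would be a competitor of
    finite energy for the capacity of [Q]. *)
Lemma capacity_eq0 Q mu C : measurable (Q : set (borel X)) ->
  capacity kappa Q = 0%E -> finite_pos kappa mu -> bounded_borel C ->
  C `<=` Q -> mu C = 0.
Proof.
move=> mQ cQ0 fmu bC CQ; have [pmu _] := fmu.
apply/eqP/negPn/negP => muC0.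
have a0 : 0 <= (mu C)^-1 by rewrite invr_ge0.
have [_ mC] := bC.
have pr := positive_radon_restr mC pmu.
have fr : finite_pos kappa (radon_restr mC mu).
  apply: (finite_pos_le hB scX hk fmu) => //.
  apply: positive_radonP => D bD; rewrite radonB radon_restrE// subr_ge0.
  apply: (positive_radon_le pmu bD) => //.
  exact: bounded_borelI.
pose tau := (mu C)^-1 *: radon_restr mC mu.
have ftau : finite_pos kappa tau by exact: (finite_posZ hB).
have tauE D : measurable (D : set (borel X)) ->
    (pos_part tau D = (mu C)^-1%:E * pos_part mu (D `&` C))%E.
  move=> mD; rewrite /tau -[(mu C)^-1]/((NngNum a0)%:num).
  by rewrite (pos_partZ hB)// (pos_part_restr hB).
(* The capacity is the inverse of this infimum, so it vanishes only if every competitor has energy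
   [+oo]. *)
have : ereal_inf [set energy kappa nu nu | nu in
    [set nu | finite_energy_pos kappa Q nu /\ pos_part nu Q = 1%E]] = +oo%E.
  by apply/eqP; rewrite -inve_eq0; apply/eqP.
move=> /ereal_inf_pinfty /(_ (energy kappa tau tau)) infE.
have := energy_fin (finite_pos_diff ftau) (finite_pos_diff ftau).
rewrite infE//; exists tau => //; split; last first.
  by rewrite tauE// (setIidr CQ) pos_part_bounded// -EFinM mulVf.
apply/finite_energy_posP; split => //.
apply/negligibleP; first exact: measurableC.
apply: (etrans (tauE _ (measurableC mQ))).
rewrite (_ : _ `&` _ = set0); last by rewrite -subset0 => x [nQ /CQ].
by rewrite measure0 mule0.
Qed.

End energy_form.

(** * The metric criterion *)

Lemma locally_closed_borel (X : ptopologicalType) (A : set X) :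
  locally_closed A -> measurable (A : set (borel X)).
Proof.
move=> [U [F [oU cF ->]]]; apply: measurableI; last exact: closed_borel.
exact: sub_sigma_algebra.
Qed.

Lemma Rmap_single (R : realType) (X : ptopologicalType)
    (I : finType) (mu : I -> signedRadon R X) (s : I -> R) (i : I) (C : set X) :
  (forall j, j != i -> mu j C = 0) -> Rmap s mu C = s i * mu i C.
Proof.
move=> h; rewrite /Rmap radon_sum (bigD1 i)// big1 => [|j ji].
  exact: addr0.
by rewrite radonZ h// mulr0.
Qed.

Theorem theorem3p5 (R : realType) (X : ptopologicalType)
    (kappa : X -> X -> \bar R) (I : finType) (A : I -> set X) (s : I -> R)
    (X_locally_compact : locally_compact [set: X])
    (X_hausdorff : hausdorff_space X)
    (X_metrizable : metrizable R X)
    (X_countable_at_infinity : countable_at_infinity X)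
    (kappa_kernel : is_kernel kappa)
    (kappa_spd : strictly_positive_definite kappa)
    (A_condenser : generalized_condenser A s)
    (A_capacity : forall i, (0 < capacity kappa (A i))%E) :
  let E := vector_measures kappa A in
  let d := vector_dist kappa s in
  [/\ Rmap s @` E `<=` finite_energy kappa,
      semimetric_on E d,
      forall mu mu1, E mu -> E mu1 ->
        (forall i j,
          energy kappa (mu i - mu1 i)%R (mu j - mu1 j)%R \is a fin_num) /\
        (((d mu mu1) ^+ 2)%:E = \sum_(i : I) \sum_(j : I)
          (s i * s j)%:E * energy kappa (mu i - mu1 i)%R (mu j - mu1 j)%R)%E,
      isometry_onto E d (Rmap s @` E) (kdist kappa) (Rmap s)
    & metric_on E d <-> essentially_disjoint kappa A].
Proof.
move=> E d.
have scX := metrizable_second_countable X_metrizable X_countable_at_infinity.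
have [B hB] := bounded_partition_exists X_hausdorff X_countable_at_infinity.
have hk := kappa_kernel; have spd := kappa_spd.
have [_ hA hs sA] := A_condenser.
have mA i : measurable (A i : set (borel X)).
  by have [_] := hA i; exact: locally_closed_borel.
have Ef mu i : E mu -> finite_pos kappa (mu i).
  by move=> /(_ i)[[? _ _] ? _].
have En mu i : E mu -> (pos_part (mu i)).-negligible (~` A i : set (borel X)).
  by move=> /(_ i)[].
have Ed mu i : E mu -> finite_diff kappa (mu i).
  by move=> Emu; apply/finite_pos_diff/Ef.
have F0 := finite_diff0 kappa.
have FP := finite_diffP hB scX hk spd.
have FC := formC hB scX hk spd.
have FPl := formPl hB scX hk spd.
have Fge0 := form_ge0 hB scX hk spd.
have Feq0 := form_eq0 hB scX hk spd.
have Rd mu : E mu -> finite_diff kappa (Rmap s mu).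
  move=> Emu.
  (* Only membership is kept here; 0 merely fills the second argument of the form. *)
  by have [] := positive_form_sum F0 FP FPl s (fun i => Ed mu i Emu) F0.
have FEP Q mu := finite_energy_posP hB scX hk spd Q mu.
have RBd mu nu : E mu -> E nu -> finite_diff kappa (Rmap s mu - Rmap s nu).
  by move=> Emu Enu; apply: (finite_diffB hB) => //; exact: Rd.
have K0 : knorm kappa (0 : signedRadon R X) = 0.
  by rewrite /knorm -/(form _ _ _) (positive_form0l F0 FPl F0) sqrtr0.
have smd : semimetric_on E d.
  split=> [mu nu _ _|mu Emu|mu nu Emu Enu|mu nu rho Emu Enu Erho].
  - exact: sqrtr_ge0.
  - by rewrite /d /vector_dist subrr K0.
  - rewrite /d /vector_dist -opprB /knorm -!/(form _ _ _).
    by rewrite (positive_formN F0 FP FC FPl (RBd _ _ Enu Emu)).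
  - rewrite /d /vector_dist.
    have -> : Rmap s mu - Rmap s rho =
        (Rmap s mu - Rmap s nu) + (Rmap s nu - Rmap s rho).
      by rewrite addrA subrK.
    exact: (positive_form_triangle F0 FP FC FPl Fge0 Feq0 (RBd _ _ Emu Enu)
      (RBd _ _ Enu Erho)).
(* The isometry holds by unfolding: [kdist] between two images under [Rmap s] is [vector_dist]. *)
split=> //.
- by move=> _ [mu Emu <-]; apply: (finite_diff_energy hB) => //; exact: Rd.
- move=> mu nu Emu Enu.
  have Bd i : finite_diff kappa (mu i - nu i).
    by apply: (finite_diffB hB) => //; exact: Ed.
  have fin i j : energy kappa (mu i - nu i) (mu j - nu j) \is a fin_num.
    exact: (energy_fin hB).
  split=> //.
  have RE : Rmap s mu - Rmap s nu = \sum_i s i *: (mu i - nu i).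
    by rewrite /Rmap -sumrB; apply: eq_bigr => i _; rewrite scalerBr.
  rewrite /d /vector_dist /knorm -/(form _ _ _) sqr_sqrtr; last first.
    exact/Fge0/RBd.
  have Fsum := positive_form_sum F0 FP FPl s Bd.
  have [Sd _] := Fsum _ F0.
  (* The form is expanded in its first argument, then by symmetry in its second. *)
  rewrite RE (Fsum _ Sd).2 -sumEFin; apply: eq_bigr => i _.
  rewrite (FC _ _ (Bd i) Sd) (Fsum _ (Bd i)).2 mulr_sumr -sumEFin.
  apply: eq_bigr => j _.
  by rewrite (FC _ _ (Bd j) (Bd i)) mulrA EFinM /form fineK.
- split=> [[_ sep] i j ij|ed].
  + apply/eqP; rewrite inve_eq0; apply/negPn/negP => cap.
    (* Without a competitor the infimum over the empty set would be [+oo] and the capacity 0. *)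
    have [tau [/FEP[ftau ntau] tau1]] :
      exists tau, finite_energy_pos kappa (A i `&` A j) tau /\
        pos_part tau (A i `&` A j) = 1%E.
      apply: contrapT => nex; move/eqP: cap; apply.
      rewrite (_ : [set _ | _ in _] = set0) ?ereal_inf0// -subset0.
      by move=> ? [tau htau _]; apply: nex; exists tau.
    pose e k : I -> signedRadon R X := fun l => if l == k then tau else 0.
    have Ee k : (k == i) || (k == j) -> E (e k).
      move=> kij l; apply/FEP.
      have [->|lk] := eqVneq l k.
        rewrite (_ : e k k = tau); last by rewrite /e eqxx.
        split=> //; apply: negligibleS ntau; apply: subsetC.
        by case/orP: kij => /eqP ->; [exact: subIsetl|exact: subIsetr].
      rewrite (_ : e k l = 0); last by rewrite /e (negbTE lk).
      split; first exact: finite_pos0.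
      apply/negligibleP; first exact: measurableC.
      exact: pos_part_0.
    have Re k : Rmap s (e k) = s k *: tau.
      rewrite /Rmap (bigD1 k)//= big1 ?addr0; first by rewrite /e eqxx.
      by move=> l lk; rewrite /e (negbTE lk) scaler0.
    (* Opposite signs would make the two plates disjoint, and [tau] would give mass 1 to the empty
       set. *)
    have sij : s i = s j.
      have A0 : s i * s j != -1.
        apply/eqP => /sA A0; move: tau1; rewrite A0 measure0 => /eqP.
        by rewrite eq_sym onee_eq0.
      move: A0; have [->|->] := hs i; have [->|->] := hs j => //.
        by rewrite mul1r eqxx.
      by rewrite mulr1 eqxx.
    have : e i = e j.
      apply: sep; [by apply: Ee; rewrite eqxx|by apply: Ee; rewrite eqxx orbT|].
      by rewrite /d /vector_dist !Re sij subrr K0.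
    move=> /(congr1 (fun f => f i)); rewrite /e eqxx (negbTE ij) => tau0.
    by move/eqP: tau1; rewrite tau0 pos_part_0 eq_sym onee_eq0.
  + split=> // mu nu Emu Enu d0.
    have REq : Rmap s mu = Rmap s nu.
      apply/eqP; rewrite -subr_eq0; apply/eqP.
      apply: (Feq0 _ (RBd _ _ Emu Enu)).
      (* [Num.sqrt] is 0 on all nonpositive reals, so [d0] yields only an upper bound; positivity of
         the form supplies the other. *)
      apply/eqP; rewrite eq_le (Fge0 _ (RBd _ _ Emu Enu)) andbT.
      by move/eqP: d0; rewrite sqrtr_eq0 => ->.
    apply/funext => i; apply: radon_eq => C bC.
    (* On this part of plate [i] no other component has mass, so the image determines [mu i]
       there. *)
    pose A' := A i `\` \bigcup_(j in [set j | j != i]) A j.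
    have mA' : measurable (A' : set (borel X)).
      apply: measurableD => //.
      by apply: countable_bigcup_measurable => [|j _] //; exact: countableP.
    have bCA' := bounded_borelI bC mA'.
    have RA' rho : E rho -> Rmap s rho (C `&` A') = s i * rho i C.
      move=> Erho; rewrite (@Rmap_single _ _ _ _ _ i); last first.
        move=> j ji; have [pj _] := Ef rho j Erho.
        apply: (negligible_radon0 pj (En rho j Erho) bCA').
        by move=> x [_ [_ nA]] Ajx; apply: nA; exists j.
      congr (_ * _); have fi := Ef rho i Erho; have [pi _] := fi.
      rewrite [RHS](radon_splitI _ bC mA') [X in _ + X](_ : _ = 0) ?addr0//.
      (* These sets cover the complement of [A'], and [rho i] charges none of them. The free index
         [i] encodes the complement of the plate; the other indices give the intersections of
         capacity zero. *)
      pose F j := if j == i then ~` A i else A i `&` A j.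
      apply: (@radon_cover0 _ _ _ _ F (enum I)) => [j|j D bD||x [_ nA']].
      + rewrite /F; case: eqP => _; first exact: measurableC.
        exact: measurableI.
      + rewrite /F; case: eqP => [_|/eqP ji];
          first exact: (negligible_radon0 pi (En _ _ Erho)).
        apply: (capacity_eq0 hB scX hk spd) => //; first exact: measurableI.
        by apply: ed; rewrite eq_sym.
      + by apply: bounded_borelI => //; exact: measurableC.
      + have [Aix|nAix] := pselect (A i x); last first.
          by exists i; rewrite ?mem_enum// /F eqxx.
        have [j ji Ajx] : exists2 j, j != i & A j x.
          by apply: contrapT => nj; apply: nA'; split.
        by exists j; rewrite ?mem_enum// /F (negbTE ji).
    (* Equal images give equal values of [s i * mu i C] and [s i * nu i C], and the sign cancels. *)
    have := RA' mu Emu; rewrite REq RA'//.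
    have [->|->] := hs i; first by rewrite !mul1r.
    by rewrite !mulN1r => /oppr_inj.
Qed.
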